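(* Let $X$ and $Y$ be compact connected manifolds, $\mathcal{A}_X\to X$ and $\mathcal{A}_Y\to Y$ Lie algebroids, and $(\varphi,f)\colon\mathcal{A}_X\to\mathcal{A}_Y$ a Lie algebroid morphism. Let $J$ be an $\mathcal{A}_X$-almost-complex structure, $\omega_Y$ an $\mathcal{A}_Y$-symplectic form and $\eta$ a closed $\mathcal{A}_X$-two-form. Assume that (i) $J$ is $(\omega_Y,\varphi)$-tame; (ii) $\eta$ tames $J|_{\ker\varphi_x}$ for all $x\in X$. Then $X$ admits an $\mathcal{A}_X$-symplectic structure.
   Context: A Lie algebroid over a manifold $X$ is a vector bundle $\mathcal{A}\to X$ with a Lie bracket on $\Gamma(\mathcal{A})$ and a vector bundle map $\rho_{\mathcal A}\colon \mathcal{A}\to TX$ (the anchor) with $[v,gw]_{\mathcal A}=g[v,w]_{\mathcal A}+(\mathcal{L}_{\rho_{\mathcal A}(v)}g)\,w$. The $\mathcal{A}$-forms $\Omega^\bullet_{\mathcal A}(X)=\Gamma(\wedge^\bullet\mathcal{A}^* )$ carry the differential $d_{\mathcal A}$ given by the Koszul formula; closed means $d_{\mathcal A}$-closed. An $\mathcal{A}$-symplectic structure (form) is a closed nondegenerate $\mathcal{A}$-two-form. A Lie algebroid morphism $(\varphi,f)\colon\mathcal{A}_X\to\mathcal{A}_Y$ is a vector bundle map $\varphi$ covering a smooth map $f\colon X\to Y$ such that $\varphi^*\colon\Omega^\bullet(\mathcal{A}_Y)\to\Omega^\bullet(\mathcal{A}_X)$ is a chain map. An $\mathcal{A}_X$-almost-complex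 structure is a (continuous) vector bundle complex structure $J$ on $\mathcal{A}_X$. $J$ is $(\omega_Y,\varphi)$-tame if $(\varphi_x^*\omega_Y)(v,Jv)>0$ for all $x\in X$ and all $v\in\mathcal{A}_{X,x}\setminus\ker\varphi_x$ (this implies $\ker\varphi_x$ is $J$-invariant). That $\eta$ tames $J|_{\ker\varphi_x}$ means $\eta(v,Jv)>0$ for all nonzero $v\in\ker\varphi_x$. *)

(* Defs.v *)
From HB Require Import structures.
From mathcomp Require Import all_boot all_order all_algebra.
From mathcomp Require Import all_classical all_reals all_analysis.

Set Implicit Arguments.
Unset Strict Implicit.
Unset Printing Implicit Defensive.
Import Order.TTheory GRing.Theory Num.Theory.
Import numFieldNormedType.Exports.

Local Open Scope classical_set_scope.
Local Open Scope ring_scope.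

(** * Smooth functions on open subsets of R^n *)

Section Smooth.
Variable R : realType.

(* [U] is meant to be open, so that the values of [g] outside [U] are
   irrelevant. *)
Fixpoint Ck_on (k : nat) (n : nat) (U : set 'rV[R]_n) (g : 'rV[R]_n -> R) :
    Prop :=
  match k with
  | 0 => forall p, U p -> {for p, continuous g}
  | k'.+1 => (forall p, U p -> differentiable g p) /\
             (forall v : 'rV[R]_n, Ck_on k' U ('D_v g))
  end.

Definition smooth_on (n : nat) (U : set 'rV[R]_n) (g : 'rV[R]_n -> R) : Prop :=
  forall k, Ck_on k U g.

Definition smooth_map_on (m n : nat) (U : set 'rV[R]_m)
    (F : 'rV[R]_m -> 'rV[R]_n) : Prop :=
  forall j, smooth_on U (fun p => F p 0 j).

Lemma near_eq_differentiable (V W : normedModType R) (f g : V -> W) (p : V) :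
  (\near p, f p = g p) -> differentiable f p -> differentiable g p.
Proof.
move=> fg df.
have -> : g = f + (g - f) by rewrite addrC subrK.
apply: differentiableD => //; set h := g - f.
have h0 : \forall q \near p, h q = 0.
  by near=> q; rewrite /h !fctE (near fg q) ?subrr//.
have ho : h \o shift p = cst (h p) + (\0 : V -> W) +o_ (0 : V) id.
  apply/eqaddoP => e e0.
  have hp : h p = 0 by exact: (nbhs_singleton h0).
  have : \forall x \near (0 : V), h (x + p) = 0.
    by move: h0; rewrite (near_shift 0) subr0.
  apply: filterS => x hx.
  by rewrite !fctE /= hx hp !addr0 subr0 normr0 mulr_ge0// ltW.
apply/diff_locallyP.
have hd : 'd h p = (\0 : V -> W) :> (V -> W).
  by apply: diff_unique => //; exact: cst_continuous.
by rewrite hd; split => //; exact: cst_continuous.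
Unshelve. all: by end_near. Qed.

Lemma differentiable_rV (V : normedModType R) (n : nat) (F : V -> 'rV[R]_n)
    (p : V) :
  (forall j, differentiable (fun q => F q 0 j) p) -> differentiable F p.
Proof.
move=> dF.
have -> : F = \sum_(j < n) (fun q => F q 0 j *: delta_mx 0 j).
  by apply/funext => q; rewrite fct_sumE [LHS]row_sum_delta.
by apply: differentiable_sum => j; exact: differentiableZl.
Qed.

Lemma derive_coord (V : normedModType R) (n : nat) (F : V -> 'rV[R]_n) (p v : V) j :
  differentiable F p -> ('D_v F p) 0 j = 'D_v (fun q => F q 0 j) p.
Proof.
move=> dF; rewrite derive_mx ?mxE//; exact: diff_derivable.
Qed.

Lemma derive_comp (U V W : normedModType R) (F : U -> V) (G : V -> W) (p w : U) :
  differentiable F p -> differentiable G (F p) ->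
  'D_w (G \o F) p = 'D_('D_w F p) G (F p).
Proof.
move=> dF dG; rewrite deriveE; last exact: differentiable_comp.
by rewrite diff_comp//= !deriveE.
Qed.

Lemma Ck_on_subset k n (U W : set 'rV[R]_n) g :
  U `<=` W -> Ck_on k W g -> Ck_on k U g.
Proof.
move=> UW; elim: k g => [g h p /UW Wp|k IH g [h1 h2]]; first exact: h.
by split=> [p /UW Wp|v]; [exact: h1|exact/IH/h2].
Qed.

Lemma Ck_on_eq k n (U : set 'rV[R]_n) f g : open U ->
  (forall p, U p -> f p = g p) -> Ck_on k U f -> Ck_on k U g.
Proof.
move=> oU.
have nU p : U p -> \near p, U p by move=> Up; exact: open_nbhs_nbhs.
elim: k f g => [f g fg h p Up|k IH f g fg [h1 h2]].
  have fgp : \near p, f p = g p by apply: filterS (nU _ Up).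
  have := h p Up; rewrite /continuous_at => hc.
  apply: cvg_trans; first exact: near_eq_cvg fgp.
  by rewrite -fg.
split=> [p Up|v].
  apply: near_eq_differentiable (h1 _ Up); by apply: filterS (nU _ Up).
apply: IH (h2 v) => p Up; apply: near_eq_derive.
by apply: filterS (nU _ Up).
Qed.

Lemma Ck_onW k n (U : set 'rV[R]_n) g : Ck_on k.+1 U g -> Ck_on k U g.
Proof.
elim: k g => [g [h _] p /h|k IH g [h1 h2]]; first exact: differentiable_continuous.
by split=> [p Up|v]; [exact: h1|exact/IH/h2].
Qed.

Lemma Ck_on_cst k n (U : set 'rV[R]_n) (a : R) : Ck_on k U (cst a).
Proof.
elim: k a => [a p _|k IH a]; first exact: cst_continuous.
split=> [p _|v]; first exact: differentiable_cst.
by rewrite (_ : 'D_v _ = cst 0)//; apply/funext => p; rewrite derive_cst.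
Qed.

Lemma Ck_onD k n (U : set 'rV[R]_n) f g : open U ->
  Ck_on k U f -> Ck_on k U g -> Ck_on k U (f + g).
Proof.
move=> oU; elim: k f g => [f g hf hg p Up|k IH f g [f1 f2] [g1 g2]].
  exact: (continuousD (hf p Up) (hg p Up)).
split=> [p Up|v]; first by apply: differentiableD; [exact: f1|exact: g1].
apply: (Ck_on_eq oU _ (IH _ _ (f2 v) (g2 v))) => p Up.
by rewrite deriveD//; apply: diff_derivable; [exact: f1|exact: g1].
Qed.

Lemma Ck_onM k n (U : set 'rV[R]_n) f g : open U ->
  Ck_on k U f -> Ck_on k U g -> Ck_on k U (f * g).
Proof.
move=> oU; elim: k f g => [f g hf hg p Up|k IH f g hf hg].
  exact: (continuousM (hf p Up) (hg p Up)).
have [[f1 f2] [g1 g2]] := (hf, hg).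
split=> [p Up|v]; first by apply: differentiableM; [exact: f1|exact: g1].
apply: (Ck_on_eq oU _ (Ck_onD oU (IH _ _ (Ck_onW hf) (g2 v))
                                 (IH _ _ (Ck_onW hg) (f2 v)))) => p Up.
by rewrite deriveM//; apply: diff_derivable; [exact: f1|exact: g1].
Qed.

Lemma Ck_on_sum k n (U : set 'rV[R]_n) m (f : 'I_m -> 'rV[R]_n -> R) :
  open U -> (forall i, Ck_on k U (f i)) -> Ck_on k U (\sum_i f i).
Proof.
move=> oU hf; elim/big_ind : _ => //; first exact: Ck_on_cst.
by move=> *; exact: Ck_onD.
Qed.

Lemma Ck_on_comp k m n (U : set 'rV[R]_m) (W : set 'rV[R]_n)
    (F : 'rV[R]_m -> 'rV[R]_n) g : open U ->
  (forall p, U p -> W (F p)) -> smooth_map_on U F -> Ck_on k W g ->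
  Ck_on k U (g \o F).
Proof.
move=> oU UW sF.
have dF p : U p -> differentiable F p.
  by move=> Up; apply: differentiable_rV => j; have [+ _] := sF j 1%N; exact.
elim: k g => [g hg p Up|k IH g [g1 g2]].
  apply: continuous_comp; first exact/differentiable_continuous/dF.
  exact/hg/UW.
split=> [p Up|v]; first by apply: differentiable_comp; [exact: dF|exact/g1/UW].
have : Ck_on k U (\sum_j ('D_v (fun q => F q 0 j)) * ('D_(delta_mx 0 j) g \o F)).
  apply: Ck_on_sum => // j; apply: Ck_onM => //; last exact: (IH _ (g2 _)).
  by have [_] := sF j k.+1; exact.
apply: Ck_on_eq => // p Up.
have [dg dFp] := (g1 _ (UW _ Up), dF _ Up).
rewrite deriveE; last exact: differentiable_comp.
rewrite diff_comp//.
rewrite /= [X in 'd g _ X]row_sum_delta linear_sum fct_sumE; apply: eq_bigr => j _.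
by rewrite linearZ /= -(deriveE _ dFp) derive_coord // -(deriveE _ dg).
Qed.

Lemma smooth_on_comp m n (U : set 'rV[R]_m) (W : set 'rV[R]_n)
    (F : 'rV[R]_m -> 'rV[R]_n) g : open U ->
  (forall p, U p -> W (F p)) -> smooth_map_on U F -> smooth_on W g ->
  smooth_on U (g \o F).
Proof. by move=> oU UW sF sg k; exact: (Ck_on_comp oU UW sF (sg k)). Qed.

Lemma smooth_on_derive n (U : set 'rV[R]_n) g v :
  smooth_on U g -> smooth_on U ('D_v g).
Proof. by move=> sg k; have [_] := sg k.+1; exact. Qed.

Lemma smooth_map_differentiable m n (U : set 'rV[R]_m)
    (F : 'rV[R]_m -> 'rV[R]_n) p :
  smooth_map_on U F -> U p -> differentiable F p.
Proof.
by move=> sF Up; apply: differentiable_rV => j; have [+ _] := sF j 1%N; exact.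
Qed.

End Smooth.

(** * Smooth manifolds *)

Section Manifold.
Variable R : realType.

(* [chart_inv] is meaningful on [chart_cod] only, [chart_map] on [chart_dom]. *)
Record chart (T : topologicalType) (n : nat) := Chart {
  chart_dom : set T;
  chart_cod : set 'rV[R]_n;
  chart_map : T -> 'rV[R]_n;
  chart_inv : 'rV[R]_n -> T;
  chart_dom_open : open chart_dom;
  chart_cod_open : open chart_cod;
  chart_map_cod : forall x, chart_dom x -> chart_cod (chart_map x);
  chart_inv_dom : forall p, chart_cod p -> chart_dom (chart_inv p);
  chart_mapK : forall x, chart_dom x -> chart_inv (chart_map x) = x;
  chart_invK : forall p, chart_cod p -> chart_map (chart_inv p) = p;
  chart_map_continuous :
    forall x, chart_dom x -> {for x, continuous chart_map};
  chart_inv_continuous :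
    forall p, chart_cod p -> {for p, continuous chart_inv}
}.

(* The image under the chart [c] of the part of [U] lying in its domain. *)
Definition chart_part (T : topologicalType) n (c : chart T n) (U : set T) :
    set 'rV[R]_n :=
  [set p | chart_cod c p /\ U (chart_inv c p)].

Record manifold := Manifold {
  man_carrier :> topologicalType;
  mdim : nat;
  man_hausdorff : hausdorff_space man_carrier;
  man_second_countable : @second_countable man_carrier;
  atlas : set (chart man_carrier mdim);
  atlas_cover : forall x, exists2 c, atlas c & chart_dom c x;
  atlas_smooth : forall c d, atlas c -> atlas d ->
    smooth_map_on (chart_part c (chart_dom d)) (chart_map d \o chart_inv c)
}.

(* [U] is meant to be open. *)
Definition smooth_fun_on (X : manifold) (U : set X) (g : X -> R) : Prop :=
  forall c, atlas c -> smooth_on (chart_part c U) (g \o chart_inv c).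

Definition smooth_fun (X : manifold) (g : X -> R) : Prop :=
  smooth_fun_on [set: X] g.

Definition smooth_map (X Y : manifold) (f : X -> Y) : Prop :=
  continuous f /\
  forall d : chart Y (mdim Y), atlas d ->
  forall j, smooth_fun_on (f @^-1` chart_dom d) (fun x => chart_map d (f x) 0 j).

Lemma chart_part_open (T : topologicalType) n (c : chart T n) (U : set T) :
  open U -> open (chart_part c U).
Proof.
move=> oU; rewrite openE => p [cp Up].
have Uc : \near p, U (chart_inv c p).
  by apply: (chart_inv_continuous cp); exact: open_nbhs_nbhs.
have cc : \near p, chart_cod c p.
  by apply: open_nbhs_nbhs; split=> //; exact: chart_cod_open.
by apply: filterS2 cc Uc => q.
Qed.

Definition chart_at (X : manifold) (x : X) : chart X (mdim X) :=
  projT1 (cid2 (atlas_cover x)).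

Lemma chart_at_atlas (X : manifold) (x : X) : atlas (chart_at x).
Proof. by rewrite /chart_at; case: cid2. Qed.

Lemma chart_at_dom (X : manifold) (x : X) : chart_dom (chart_at x) x.
Proof. by rewrite /chart_at; case: cid2. Qed.

End Manifold.

(** * Vector bundles *)

Section VectorBundle.
Variable R : realType.

(* Off [triv_dom] the linear maps below carry no information. *)
Record local_trivialization (X : manifold R) (r : nat) (E : X -> lmodType R) :=
  LocalTrivialization {
  triv_dom : set X;
  triv_coord : forall x, {linear E x -> 'rV[R]_r};
  triv_vec : forall x, {linear 'rV[R]_r -> E x};
  triv_dom_open : open triv_dom;
  triv_coordK : forall x, triv_dom x -> cancel (triv_coord x) (triv_vec x);
  triv_vecK : forall x, triv_dom x -> cancel (triv_vec x) (triv_coord x)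
}.

Definition frame (X : manifold R) r (E : X -> lmodType R)
    (t : local_trivialization r E) (i : 'I_r) (x : X) : E x :=
  triv_vec t x (delta_mx 0 i).

(* The smooth structure of the total space is the one induced by a cover by
   local trivializations with smooth transition matrices. *)
Record vector_bundle (X : manifold R) := VectorBundle {
  rank : nat;
  fiber :> X -> lmodType R;
  trivs : set (local_trivialization rank fiber);
  trivs_cover : forall x, exists2 t, trivs t & triv_dom t x;
  trivs_smooth : forall s t, trivs s -> trivs t -> forall i j,
    smooth_fun_on (triv_dom s `&` triv_dom t)
      (fun x => triv_coord t x (frame s i x) 0 j)
}.

Definition smooth_section (X : manifold R) (E : vector_bundle X)
    (v : forall x, E x) : Prop :=
  forall t, trivs t -> forall j,
    smooth_fun_on (triv_dom t) (fun x => triv_coord t x (v x) 0 j).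

(* [f] is meant to be smooth. *)
Record bundle_map (X Y : manifold R) (f : X -> Y)
    (E : vector_bundle X) (F : vector_bundle Y) := BundleMap {
  bundle_map_fun :> forall x, {linear E x -> F (f x)};
  bundle_map_smooth : forall (s : local_trivialization (rank E) E)
      (t : local_trivialization (rank F) F), trivs s -> trivs t -> forall i j,
    smooth_fun_on (triv_dom s `&` f @^-1` triv_dom t)
      (fun x => triv_coord t (f x) (bundle_map_fun x (frame s i x)) 0 j)
}.

End VectorBundle.

(** * The tangent bundle *)

(* The derivative of the transition map from [c] to [d] at the point [x]. It is
   locked since unfolding differentials makes unification very slow. *)
HB.lock Definition transition_diff (R : realType) (X : manifold R)
    (c d : chart R X (mdim X)) (x : X) :
    {linear 'rV[R]_(mdim X) -> 'rV[R]_(mdim X)} :=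
  'd (chart_map d \o chart_inv c) (chart_map c x).

Section TangentBundle.
Variables (R : realType) (X : manifold R).
Local Notation n := (mdim X).

(* A tangent vector at [x] is represented by its components in the chart
   [chart_at x]; its components in another chart are obtained by applying the
   derivative of the transition map. *)
Definition tangent_space (x : X) : lmodType R := 'rV[R]_n.

Lemma transition_differentiable (c d : chart R X n) (x : X) :
  atlas c -> atlas d -> chart_dom c x -> chart_dom d x ->
  differentiable (chart_map d \o chart_inv c) (chart_map c x).
Proof.
move=> ac ad cx dx; apply: (smooth_map_differentiable (atlas_smooth ac ad)).
by split; [exact: chart_map_cod|rewrite /= chart_mapK].
Qed.

Lemma transition_diffE (c d : chart R X n) (x : X) (w : 'rV[R]_n) :
  atlas c -> atlas d -> chart_dom c x -> chart_dom d x ->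
  transition_diff c d x w =
    'D_w (chart_map d \o chart_inv c) (chart_map c x).
Proof.
move=> ac ad cx dx; rewrite unlock.
exact/esym/deriveE/(transition_differentiable ac ad cx dx).
Qed.

Lemma chart_inv_near (c : chart R X n) (U : set X) (x : X) :
  open U -> chart_dom c x -> U x ->
  \forall p \near chart_map c x, chart_part c U p.
Proof.
move=> oU cx Ux; apply: open_nbhs_nbhs; split; first exact: chart_part_open.
by split; [exact: chart_map_cod|rewrite chart_mapK].
Qed.

Lemma transition_diff_comp (c d e : chart R X n) (x : X) (w : 'rV[R]_n) :
  atlas c -> atlas d -> atlas e ->
  chart_dom c x -> chart_dom d x -> chart_dom e x ->
  transition_diff d e x (transition_diff c d x w) = transition_diff c e x w.
Proof.
move=> ac ad ae cx dx ex.
have dF := transition_differentiable ac ad cx dx.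
have dG := transition_differentiable ad ae dx ex.
rewrite (transition_diffE w ac ad cx dx) (transition_diffE _ ad ae dx ex).
rewrite (transition_diffE w ac ae cx ex).
have dc : chart_map d x = (chart_map d \o chart_inv c) (chart_map c x).
  by rewrite /= chart_mapK.
move: dG; rewrite dc => dG; rewrite -(derive_comp w dF dG).
apply: near_eq_derive.
apply: filterS (chart_inv_near (chart_dom_open d) cx dx) => p [_ dp] /=.
by rewrite chart_mapK.
Qed.

Lemma transition_diff_id (c : chart R X n) (x : X) (w : 'rV[R]_n) :
  atlas c -> chart_dom c x -> transition_diff c c x w = w.
Proof.
move=> ac cx; rewrite (transition_diffE w ac ac cx cx) -[RHS](derive_id (chart_map c x) w).
apply: near_eq_derive.
apply: filterS (chart_inv_near (chart_dom_open c) cx cx) => p [cp _] /=.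
exact: chart_invK.
Qed.

Program Definition tangent_triv (c : chart R X n) (ac : atlas c) :
    local_trivialization n tangent_space :=
  @LocalTrivialization R X n tangent_space (chart_dom c)
    (fun x => transition_diff (chart_at x) c x)
    (fun x => transition_diff c (chart_at x) x) (chart_dom_open c) _ _.
Next Obligation.
move=> c ac x cx w.
rewrite transition_diff_comp ?transition_diff_id//;
  by [exact: chart_at_atlas|exact: chart_at_dom].
Qed.
Next Obligation.
move=> c ac x cx w.
rewrite transition_diff_comp ?transition_diff_id//;
  by [exact: chart_at_atlas|exact: chart_at_dom].
Qed.

Definition tangent_trivs : set (local_trivialization n tangent_space) :=
  [set t | exists c (ac : atlas c), t = tangent_triv ac].

Lemma tangent_trivs_cover (x : X) : exists2 t, tangent_trivs t & triv_dom t x.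
Proof.
have [c ac cx] := atlas_cover x.
by exists (tangent_triv ac) => //; exists c, ac.
Qed.

Lemma tangent_trivs_smooth s t : tangent_trivs s -> tangent_trivs t ->
  forall i j, smooth_fun_on (triv_dom s `&` triv_dom t)
    (fun x => triv_coord t x (frame s i x) 0 j).
Proof.
move=> [c [ac ->]] [d [ad ->]] i j e ae /=.
have oU : open (chart_part e (chart_dom c `&` chart_dom d)).
  by apply: chart_part_open; apply: openI; exact: chart_dom_open.
pose F := chart_map c \o chart_inv e.
pose g := 'D_(delta_mx 0 i)
  (fun p : 'rV[R]_n => (chart_map d \o chart_inv c) p 0 j).
have sg : smooth_on (chart_part c (chart_dom d)) g.
  by apply: smooth_on_derive; exact: atlas_smooth.
have sF : smooth_map_on (chart_part e (chart_dom c `&` chart_dom d)) F.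
  move=> k l; apply: Ck_on_subset (atlas_smooth ae ac k l).
  by move=> p [ep [cp _]].
have UW p : chart_part e (chart_dom c `&` chart_dom d) p ->
    chart_part c (chart_dom d) (F p).
  by move=> [ep [cp dp]]; split;
    [exact: chart_map_cod|rewrite /F /= chart_mapK].
have := smooth_on_comp oU UW sF sg => sgF k.
apply: Ck_on_eq (sgF k) => // p [ep [cp dp]].
rewrite /frame /= transition_diff_comp//;
  [|exact: chart_at_atlas|exact: chart_at_dom].
by rewrite transition_diffE// derive_coord//; exact: transition_differentiable.
Qed.

Definition tangent_bundle : vector_bundle X :=
  VectorBundle tangent_trivs_cover tangent_trivs_smooth.

(* Independent of the chart at [x] when [g] is smooth. *)
Definition lie_derivative (w : forall x, tangent_bundle x) (g : X -> R) :
    X -> R :=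
  fun x => 'D_(w x : 'rV[R]_n) (g \o chart_inv (chart_at x))
             (chart_map (chart_at x) x).

End TangentBundle.

(** * Lie algebroids *)

Section LieAlgebroid.
Variable R : realType.

Record lie_algebroid (X : manifold R) := LieAlgebroid {
  la_bundle :> vector_bundle X;
  anchor : bundle_map (fun x => x) la_bundle (tangent_bundle X);
  (* Only the values of the bracket on smooth sections are relevant. *)
  bracket : (forall x, la_bundle x) -> (forall x, la_bundle x) ->
            forall x, la_bundle x;
  bracket_smooth : forall v w, smooth_section v -> smooth_section w ->
    smooth_section (bracket v w);
  bracket_linear : forall (a : R) u v w,
    smooth_section u -> smooth_section v -> smooth_section w -> forall x,
    bracket (fun y => a *: u y + v y) w x = a *: bracket u w x + bracket v w x;
  bracket_antisym : forall v w, smooth_section v -> smooth_section w ->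
    forall x, bracket v w x = - bracket w v x;
  bracket_jacobi : forall u v w,
    smooth_section u -> smooth_section v -> smooth_section w -> forall x,
    bracket u (bracket v w) x + bracket v (bracket w u) x
      + bracket w (bracket u v) x = 0;
  bracket_leibniz : forall (g : X -> R) v w,
    smooth_fun g -> smooth_section v -> smooth_section w -> forall x,
    bracket v (fun y => g y *: w y) x =
      g x *: bracket v w x + lie_derivative (fun y => anchor y (v y)) g x *: w x
}.

(** ** Forms and the differential *)

Section Forms.
Variables (X : manifold R) (A : lie_algebroid X).

Definition set_arg (k : nat) (x : X) (v : 'I_k -> A x) (i : 'I_k) (u : A x) :
    'I_k -> A x :=
  fun l => if l == i then u else v l.

Record aform (k : nat) := AForm {
  form_val :> forall x, ('I_k -> A x) -> R;
  form_linear : forall x (v : 'I_k -> A x) i (a : R) (u w : A x),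
    form_val (set_arg v i (a *: u + w)) =
      a * form_val (set_arg v i u) + form_val (set_arg v i w);
  form_alternating : forall x (v : 'I_k -> A x) i j,
    i != j -> v i = v j -> form_val v = 0;
  form_smooth : forall t : local_trivialization (rank A) A, trivs t ->
    forall s : 'I_k -> 'I_(rank A),
    smooth_fun_on (triv_dom t) (fun x => form_val (fun l => frame t (s l) x))
}.

(* The Koszul formula
     sum_i (-1)^i L_(rho v_i) (omega (v_0, .., ^v_i, .., v_k))
     + sum_(i < j) (-1)^(i+j)
         omega ([v_i, v_j], v_0, .., ^v_i, .., ^v_j, .., v_k),
   where [bump j (bump i l.-1)] is the index of the entry number [l.-1] in the
   sequence 0, .., ^i, .., ^j, .., k. *)
Definition koszul (k : nat) (omega : forall x, ('I_k -> A x) -> R)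
    (v : 'I_k.+1 -> forall x, A x) (x : X) : R :=
  \sum_(i < k.+1) (-1) ^+ i *
    lie_derivative (fun y => anchor A y (v i y))
      (fun y => omega y (fun l => v (lift i l) y)) x
  + \sum_(i < k.+1) \sum_(j < k.+1 | (i < j)%N) (-1) ^+ (i + j) *
      omega x (fun l : 'I_k => if (l : nat) is l'.+1
        then v (inord (bump j (bump i l'))) x
        else bracket (v i) (v j) x).

(* [theta] is d_A [omega]. *)
Definition is_differential (k : nat) (omega : forall x, ('I_k -> A x) -> R)
    (theta : forall x, ('I_k.+1 -> A x) -> R) : Prop :=
  forall v : 'I_k.+1 -> forall x, A x, (forall i, smooth_section (v i)) ->
  forall x, theta x (fun i => v i x) = koszul omega v x.

Definition closed_form (k : nat) (omega : aform k) : Prop :=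
  is_differential omega (fun x _ => 0).

Definition pair_arg (x : X) (v w : A x) : 'I_2 -> A x :=
  fun l => if l == ord0 then v else w.

Definition nondegenerate_form (omega : aform 2) : Prop :=
  forall x (v : A x), (forall w, omega x (pair_arg v w) = 0) -> v = 0.

Definition symplectic (omega : aform 2) : Prop :=
  closed_form omega /\ nondegenerate_form omega.

Record almost_complex := AlmostComplex {
  ac_fun :> forall x, {linear A x -> A x};
  ac_square : forall x (v : A x), ac_fun x (ac_fun x v) = - v;
  ac_continuous : forall t : local_trivialization (rank A) A, trivs t ->
    forall i j x, triv_dom t x ->
    {for x, continuous
      (fun y => triv_coord t y (ac_fun y (frame t i y)) 0 j : R)}
}.

End Forms.

(** ** Morphisms *)

Definition pullback (X Y : manifold R) (f : X -> Y) (A : lie_algebroid X)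
    (B : lie_algebroid Y) (phi : bundle_map f A B) (k : nat)
    (omega : forall y, ('I_k -> B y) -> R) : forall x, ('I_k -> A x) -> R :=
  fun x v => omega (f x) (fun l => phi x (v l)).

Record lie_algebroid_morphism (X Y : manifold R) (f : X -> Y)
    (A : lie_algebroid X) (B : lie_algebroid Y) := LieAlgebroidMorphism {
  mor_map :> bundle_map f A B;
  mor_base_smooth : smooth_map f;
  mor_chain : forall k (omega : aform B k) (theta : aform B k.+1),
    is_differential omega theta ->
    is_differential (pullback mor_map omega) (pullback mor_map theta)
}.

(** ** Tameness *)

Definition tame_wrt (X Y : manifold R) (f : X -> Y) (A : lie_algebroid X)
    (B : lie_algebroid Y) (J : almost_complex A) (omega : aform B 2)
    (phi : lie_algebroid_morphism f A B) : Prop :=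
  forall x (v : A x), phi x v <> 0 ->
    0 < pullback phi omega (pair_arg v (J x v)).

Definition tames_on_kernel (X Y : manifold R) (f : X -> Y)
    (A : lie_algebroid X) (B : lie_algebroid Y)
    (phi : lie_algebroid_morphism f A B) (eta : aform A 2)
    (J : almost_complex A) (x : X) : Prop :=
  forall v : A x, phi x v = 0 -> v <> 0 -> 0 < eta x (pair_arg v (J x v)).

End LieAlgebroid.

(* Main.v *)
Require Import Defs.
From mathcomp Require Import all_boot all_order all_algebra.
From mathcomp Require Import all_classical all_reals all_analysis.

Set Implicit Arguments.
Unset Strict Implicit.
Unset Printing Implicit Defensive.
Import Order.TTheory GRing.Theory Num.Theory.
Import numFieldNormedType.Exports.

(** The symplectic form is [phi^* omega_Y + t eta] for a small [t > 0].

    It is closed because [phi^*] is a chain map and the Koszul formula is linear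
    in the form ([pullback_closed], [closed_form_comb]).  Any form [omega] with
    [omega (v, J v) > 0] for every nonzero [v] is nondegenerate, so it remains
    to find one [t] for which [phi^* omega_Y + t eta] tames [J] at all points.
    Write [P v] and [Q v] for the values of [phi^* omega_Y] and [eta] on
    [(v, J v)].  Tameness gives [P >= 0], with [P v = 0] only on the kernel of
    [phi], and there [Q v > 0] when [v] is nonzero.  Around a vector with
    [P v > 0] the sum [P + t Q] is positive for small [t] by continuity; around
    a vector with [P v = 0] it is positive for every [t > 0], since [Q] stays
    positive and [P] nonnegative ([near_positive_perturbation]).  Both functions
    are quadratic on fibres, so only unit vectors matter, and the unit spheres
    over the compact base leave a single [t] that works everywhere
    ([positive_perturbation]).

    Smoothness of [phi^* omega_Y], smoothness of a form evaluated on sections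
    and continuity of [P] and [Q] are one and the same algebraic fact
    ([form_eval_closed]): a form evaluated on vectors is a polynomial in their
    frame coordinates and in the values of the form on the frame. *)

Local Open Scope classical_set_scope.
Local Open Scope ring_scope.

(** * Smooth functions on manifolds *)

Section SmoothFunctions.
Variable R : realType.

Lemma Ck_on_local k n (U : set 'rV[R]_n) (g : 'rV[R]_n -> R) :
  (forall p, U p -> exists2 W : set 'rV[R]_n, W p & Ck_on k W g) -> Ck_on k U g.
Proof.
elim: k g => [g loc p Up|k IH g loc].
  by have [W Wp cg] := loc p Up; exact: cg.
split=> [p Up|v]; first by have [W Wp [dg _]] := loc p Up; exact: dg.
by apply: IH => p Up; have [W Wp [_ dg]] := loc p Up; exists W => //; exact: dg.
Qed.

Section OnManifold.
Variable X : manifold R.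
Implicit Types (U W : set X) (g h : X -> R).

Lemma smooth_fun_on_sub U W g :
  U `<=` W -> smooth_fun_on W g -> smooth_fun_on U g.
Proof.
move=> UW sg c ac k; apply: Ck_on_subset (sg c ac k) => p [cp Up].
by split=> //; exact: UW.
Qed.

Lemma smooth_fun_on_local U g :
  (forall x, U x -> exists2 W : set X, W x & smooth_fun_on W g) ->
  smooth_fun_on U g.
Proof.
move=> loc c ac k; apply: Ck_on_local => p [cp Up].
have [W Wp sg] := loc _ Up.
by exists (chart_part c W) => //; exact: sg.
Qed.

Lemma smooth_fun_on_eq U g h : open U ->
  (forall x, U x -> g x = h x) -> smooth_fun_on U g -> smooth_fun_on U h.
Proof.
move=> oU gh sg c ac k; apply: Ck_on_eq (sg c ac k); first exact: chart_part_open.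
by move=> p [_ Up]; exact: gh.
Qed.

Lemma smooth_fun_on_cst U (a : R) : smooth_fun_on U (fun=> a).
Proof. by move=> c ac k; exact: Ck_on_cst. Qed.

Lemma smooth_fun_onD U g h : open U ->
  smooth_fun_on U g -> smooth_fun_on U h -> smooth_fun_on U (fun x => g x + h x).
Proof.
move=> oU sg sh c ac k.
exact: (Ck_onD (chart_part_open oU) (sg c ac k) (sh c ac k)).
Qed.

Lemma smooth_fun_onM U g h : open U ->
  smooth_fun_on U g -> smooth_fun_on U h -> smooth_fun_on U (fun x => g x * h x).
Proof.
move=> oU sg sh c ac k.
exact: (Ck_onM (chart_part_open oU) (sg c ac k) (sh c ac k)).
Qed.

Lemma smooth_fun_on_continuous U g x : open U -> smooth_fun_on U g -> U x ->
  {for x, continuous g}.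
Proof.
move=> oU sg Ux; set c := chart_at x.
have cx : chart_dom c x by exact: chart_at_dom.
have part : chart_part c U (chart_map c x).
  by split; [exact: chart_map_cod|rewrite chart_mapK].
have sc := sg c (chart_at_atlas x) 0%N _ part.
have : (g \o chart_inv c \o chart_map c) y @[y --> x] --> g x.
  rewrite -{2}(chart_mapK cx).
  by apply: continuous_comp sc; exact: chart_map_continuous.
apply: cvg_trans; apply: near_eq_cvg.
have : \forall y \near x, chart_dom c y.
  by apply: open_nbhs_nbhs; split=> //; exact: chart_dom_open.
by apply: filterS => y cy; rewrite /= chart_mapK.
Qed.

Lemma smooth_fun_differentiable g x : smooth_fun g ->
  differentiable (g \o chart_inv (chart_at x)) (chart_map (chart_at x) x).
Proof.
move=> sg; have [+ _] := sg _ (chart_at_atlas x) 1%N; apply.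
by split=> //; apply: chart_map_cod; exact: chart_at_dom.
Qed.

Lemma lie_derivative_comb (w : forall x, tangent_bundle X x) g h (t : R) x :
  smooth_fun g -> smooth_fun h ->
  lie_derivative w (fun y => g y + t * h y) x =
    lie_derivative w g x + t * lie_derivative w h x.
Proof.
move=> /(@smooth_fun_differentiable _ x) dg /(@smooth_fun_differentiable _ x) dh.
rewrite /lie_derivative; set c := chart_at x.
rewrite (_ : _ \o _ = (g \o chart_inv c) + t *: (h \o chart_inv c))//.
rewrite deriveD ?deriveZ//; try exact: diff_derivable.
by apply: derivableZ; exact: diff_derivable.
Qed.

End OnManifold.

(** Smoothness is tested after restricting to preimages of chart domains of the
    target, where [g \o f] factors through the coordinates of [f]. *)
Lemma smooth_fun_on_comp (X Y : manifold R) (f : X -> Y) (V : set Y)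
    (g : Y -> R) : smooth_map f -> open V -> smooth_fun_on V g ->
  smooth_fun_on (f @^-1` V) (g \o f).
Proof.
move=> [cf sf] oV sg; apply: smooth_fun_on_local => x Vfx.
have [d ad dfx] := atlas_cover (f x).
exists (f @^-1` (V `&` chart_dom d)) => // c ac k.
have oW : open (chart_part c (f @^-1` (V `&` chart_dom d))).
  apply: chart_part_open; move/continuousP: cf; apply.
  by apply: openI => //; exact: chart_dom_open.
pose F := chart_map d \o f \o chart_inv c.
have sF : smooth_map_on (chart_part c (f @^-1` (V `&` chart_dom d))) F.
  by move=> j l; apply: Ck_on_subset (sf d ad j c ac l) => p [cp []].
have maps p : chart_part c (f @^-1` (V `&` chart_dom d)) p ->
    chart_part d V (F p).
  by move=> [cp [Vp dp]]; split;
    [exact: chart_map_cod|rewrite /F /= chart_mapK].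
apply: Ck_on_eq (smooth_on_comp oW maps sF (sg d ad) k) => //.
by move=> p [cp [Vp dp]]; rewrite /F /= chart_mapK.
Qed.

End SmoothFunctions.

(** * Forms on Lie algebroids *)

Section FormEvaluation.
Variables (R : realType) (Y : manifold R) (B : lie_algebroid Y) (k : nat).
Implicit Types (omega : aform B k).

Lemma triv_expand (t : local_trivialization (rank B) B) y (u : B y) :
  triv_dom t y -> u = \sum_j triv_coord t y u 0 j *: frame t j y.
Proof.
move=> ty; rewrite -[LHS](triv_coordK ty) [X in triv_vec t y X]row_sum_delta.
by rewrite linear_sum; apply: eq_bigr => j _; rewrite linearZ.
Qed.

Lemma form_zero omega y (v : 'I_k -> B y) i : omega y (set_arg v i 0) = 0.
Proof.
have := form_linear omega v i 1 0 0; rewrite scale1r mul1r addr0.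
by rewrite -{1}[omega y _]addr0 => /addrI.
Qed.

Lemma form_scale omega y (v : 'I_k -> B y) i (a : R) u :
  omega y (set_arg v i (a *: u)) = a * omega y (set_arg v i u).
Proof. by have := form_linear omega v i a u 0; rewrite form_zero !addr0. Qed.

Lemma form_sum omega y (v : 'I_k -> B y) i m (a : 'I_m -> R)
    (e : 'I_m -> B y) :
  omega y (set_arg v i (\sum_j a j *: e j)) =
    \sum_j a j * omega y (set_arg v i (e j)).
Proof.
elim/big_rec2 : _ => [|j b u _ <-]; first exact: form_zero.
exact: form_linear.
Qed.

(** By multilinearity the value of a form on vectors is a polynomial in their
    coordinates and in the values of the form on frame vectors, hence lies in
    any algebra [S] of functions containing these.  The vectors are taken along
    a map [h] into the base so as to cover at once sections over an open set
    ([h] the identity), vectors in the image of a bundle map ([h] its base map)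
    and vectors varying in a trivialized bundle ([h] the projection).  Since
    coordinates determine a vector on [triv_dom t] only, [S] is insensitive to
    values elsewhere. *)
Lemma form_eval_closed omega (t : local_trivialization (rank B) B)
    (T : Type) (h : T -> Y) (S : set (T -> R)) :
  (forall g g', (forall p, triv_dom t (h p) -> g p = g' p) -> S g -> S g') ->
  (forall a, S (fun=> a)) ->
  (forall g g', S g -> S g' -> S (fun p => g p + g' p)) ->
  (forall g g', S g -> S g' -> S (fun p => g p * g' p)) ->
  (forall s, S (fun p => omega (h p) (fun l => frame t (s l) (h p)))) ->
  forall u : 'I_k -> forall p, B (h p),
  (forall l j, S (fun p => triv_coord t (h p) (u l p) 0 j)) ->
  S (fun p => omega (h p) (fun l => u l p)).
Proof.
move=> Seq Scst SD SM Sframe u Su.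
have Ssum m (F : 'I_m -> T -> R) : (forall j, S (F j)) ->
    S (fun p => \sum_j F j p).
  elim: m F => [|m IH] F SF.
    by apply: Seq (Scst 0) => p _; rewrite big_ord0.
  apply: (Seq _ _ _ (SD _ _ (SF ord0) (IH (fun j => F (lift ord0 j)) _))) => //.
  by move=> p _; rewrite big_ord_recl.
(* Entries are replaced by frame vectors from the last to the first; [m] counts
   those still arbitrary. *)
suff frames_from m : (forall l : 'I_k, (m <= l)%N ->
    exists j, forall p, u l p = frame t j (h p)) ->
    S (fun p => omega (h p) (fun l => u l p)).
  by apply: (frames_from k) => l; rewrite leqNgt ltn_ord.
elim: m u Su => [|m IH] u Su uframe.
  have [s us] := choice (fun l => uframe l (leq0n l)).
  by apply: Seq (Sframe s) => p _; congr (omega _ _); apply/funext => l.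
have [km|mk] := leqP k m.
  by apply: IH => // l; rewrite leqNgt (leq_trans (ltn_ord l)).
pose i := Ordinal mk.
pose w j l p := if l == i then frame t j (h p) else u l p.
have Sw j : S (fun p => omega (h p) (fun l => w j l p)).
  apply: IH => [l j'|l ml]; rewrite /w; have [_|li] := eqVneq l i.
  - apply: Seq (Scst ((delta_mx 0 j : 'rV[R]_(rank B)) 0 j')) => p hp.
    by rewrite triv_vecK.
  - exact: Su.
  - by exists j.
  - by apply: uframe; rewrite ltn_neqAle ml andbT eq_sym.
apply: Seq (Ssum _ _ (fun j => SM _ _ (Su i j) (Sw j))) => p hp.
have -> : (fun l => u l p) = set_arg (fun l => u l p) i (u i p).
  by apply/funext => l; rewrite /set_arg; case: eqP => [->|].
by rewrite (triv_expand (u i p) hp) form_sum -(triv_expand (u i p) hp).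
Qed.

Lemma form_smooth_sections omega (v : 'I_k -> forall y, B y) :
  (forall l, smooth_section (v l)) ->
  smooth_fun (fun y => omega y (fun l => v l y)).
Proof.
move=> sv; apply: smooth_fun_on_local => y _.
have [t At ty] := trivs_cover B y; exists (triv_dom t) => //.
have ot := triv_dom_open t.
apply: (@form_eval_closed omega t Y id (@smooth_fun_on R Y (triv_dom t))).
- by move=> g g' gg'; exact: smooth_fun_on_eq.
- by move=> a; exact: smooth_fun_on_cst.
- by move=> g g'; exact: smooth_fun_onD.
- by move=> g g'; exact: smooth_fun_onM.
- by move=> s; exact: form_smooth.
- by move=> l j; exact: sv.
Qed.

Program Definition form_comb (omega theta : aform B k) (t : R) : aform B k :=
  @AForm _ _ _ _ (fun y v => omega y v + t * theta y v) _ _ _.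
Next Obligation.
move=> omega theta t y v i a u w /=.
by rewrite !form_linear mulrDr mulrDr addrACA mulrCA.
Qed.
Next Obligation.
move=> omega theta t y v i j ij vij /=.
by rewrite !(form_alternating _ ij vij) mulr0 addr0.
Qed.
Next Obligation.
move=> omega theta t s As l; have os := triv_dom_open s.
apply: smooth_fun_onD => //; first exact: form_smooth.
apply: smooth_fun_onM => //; last exact: form_smooth.
exact: smooth_fun_on_cst.
Qed.

Program Definition zero_form : aform B k :=
  @AForm _ _ _ _ (fun y v => 0) _ _ _.
Next Obligation. by move=> *; rewrite mulr0 addr0. Qed.
Next Obligation. by []. Qed.
Next Obligation. by move=> *; exact: smooth_fun_on_cst. Qed.

(** The Lie derivatives in the Koszul formula are additive on differentiable
    functions only, whence the need for [form_smooth_sections]. *)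
Lemma koszul_comb omega theta (t : R) (v : 'I_k.+1 -> forall y, B y) y :
  (forall i, smooth_section (v i)) ->
  koszul (form_comb omega theta t) v y = koszul omega v y + t * koszul theta v y.
Proof.
move=> sv; rewrite /koszul mulrDr addrACA; congr (_ + _).
  rewrite mulr_sumr -big_split; apply: eq_bigr => i _.
  rewrite lie_derivative_comb; [|exact: form_smooth_sections..].
  by rewrite mulrDr mulrCA.
rewrite mulr_sumr -big_split; apply: eq_bigr => i _.
rewrite mulr_sumr -big_split; apply: eq_bigr => j _.
by rewrite mulrDr mulrCA.
Qed.

Lemma closed_form_comb omega theta (t : R) :
  closed_form omega -> closed_form theta -> closed_form (form_comb omega theta t).
Proof.
move=> dw dt v sv y.
by rewrite koszul_comb// -(dw v sv) -(dt v sv) mulr0 addr0.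
Qed.

End FormEvaluation.

Section Pullback.
Variables (R : realType) (X Y : manifold R) (f : X -> Y).
Variables (A : lie_algebroid X) (B : lie_algebroid Y).
Variable phi : lie_algebroid_morphism f A B.

Lemma pullback_set_arg k (omega : aform B k) x (v : 'I_k -> A x) i u :
  pullback phi omega (set_arg v i u) =
    omega (f x) (set_arg (fun l => phi x (v l)) i (phi x u)).
Proof.
by congr (omega _ _); apply/funext => l; rewrite /set_arg; case: ifP.
Qed.

Lemma pullback_smooth k (omega : aform B k)
    (s : local_trivialization (rank A) A) (i : 'I_k -> 'I_(rank A)) :
  trivs s -> smooth_fun_on (triv_dom s)
    (fun x => pullback phi omega (fun l => frame s (i l) x)).
Proof.
move=> As; apply: smooth_fun_on_local => x sx.
have [t Bt tfx] := trivs_cover B (f x).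
have sf := mor_base_smooth phi.
pose W := triv_dom s `&` f @^-1` triv_dom t.
have oW : open W.
  apply: openI; first exact: triv_dom_open.
  by case: sf => /continuousP cf _; apply: cf; exact: triv_dom_open.
exists W => //.
apply: (@form_eval_closed R Y B k omega t X f (@smooth_fun_on R X W) _ _ _ _ _
  (fun l x => phi x (frame s (i l) x))).
- by move=> g g' gg'; apply: smooth_fun_on_eq => // y [_]; exact: gg'.
- by move=> a; exact: smooth_fun_on_cst.
- by move=> g g'; exact: smooth_fun_onD.
- by move=> g g'; exact: smooth_fun_onM.
- move=> l; apply: (@smooth_fun_on_sub _ _ _ (f @^-1` triv_dom t)).
    by move=> y [].
  exact: (smooth_fun_on_comp sf (triv_dom_open t) (form_smooth omega Bt l)).
- by move=> l j; exact: bundle_map_smooth.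
Qed.

Program Definition pullback_form k (omega : aform B k) : aform A k :=
  @AForm _ _ _ _ (pullback phi omega) _ _ _.
Next Obligation.
move=> k omega x v i a u w.
by rewrite !pullback_set_arg linearP form_linear.
Qed.
Next Obligation.
move=> k omega x v i j ij vij.
by apply: (form_alternating _ ij); rewrite vij.
Qed.
Next Obligation. by move=> k omega s As i; exact: pullback_smooth. Qed.

(** Closedness says that the zero form is the differential, and the pullback of
    the zero form vanishes by definition. *)
Lemma pullback_closed k (omega : aform B k) :
  closed_form omega -> closed_form (pullback_form omega).
Proof.
exact: (@mor_chain _ _ _ _ _ _ phi k omega (zero_form B k.+1)).
Qed.

End Pullback.

(** * Positivity of small perturbations *)

Section Positivity.
Variables (R : realType) (X : manifold R).

(** Continuity of [Q] on the total space of [E], read in the local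
    trivializations, which determine the topology of that space. *)
Definition fiberwise_continuous (E : vector_bundle X) (Q : forall x, E x -> R) :=
  forall s, trivs s -> forall x (c : 'rV[R]_(rank E)), triv_dom s x ->
  {for (x, c), continuous (fun p : X * 'rV[R]_(rank E) =>
                             Q p.1 (triv_vec s p.1 p.2))}.

(** Only the homogeneity of quadratic forms is kept: it is what reduces
    positivity to unit vectors. *)
Definition homogeneous2 (E : vector_bundle X) (Q : forall x, E x -> R) :=
  forall x a (v : E x), Q x (a *: v) = a ^+ 2 * Q x v.

Lemma compact_unit_sphere n : compact [set c : 'rV[R]_n | `|c| = 1].
Proof.
apply: bounded_closed_compact.
  by exists 1; split=> // M M1 c /= ->; exact: ltW.
rewrite (_ : [set _ | _] = Num.norm @^-1` [set (1 : R)])//.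
apply: preimage_closed; last exact: closed_eq.
by move=> c _; exact: norm_continuous.
Qed.

(** If [f p = 0] then [g] is positive near [p] and every [t > 0] will do; if
    [f p > 0] then [f + t g] tends to [f p] as [(q, t)] tends to [(p, 0)]. *)
Lemma near_positive_perturbation (T : topologicalType) (f g : T -> R) (p : T) :
  {for p, continuous f} -> {for p, continuous g} ->
  (forall q, 0 <= f q) -> (f p = 0 -> 0 < g p) ->
  \forall q \near p & t \near 0^'+, 0 < f q + t * g q.
Proof.
move=> cf cg f0 g0; case: (eqVneq (f p) 0) => [/g0 gp|fp].
  exists ([set q | 0 < g q], [set t | 0 < t]) => [|[q t] [/= gq t0]].
    split; first exact: (cvgr_gt _ cg _ gp).
    exact: nbhs_right_gt.
  by rewrite ltr_wpDl// mulr_gt0.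
have fp0 : 0 < f p + 0 * g p by rewrite mul0r addr0 lt_neqAle eq_sym fp f0.
have fstp : (fun q : T * R => q.1) @ filter_prod (nbhs p) (0 : R)^'+ --> p.
  exact: cvg_fst.
have cvt : (fun q : T * R => f q.1 + q.2 * g q.1) @ filter_prod (nbhs p) 0^'+
    --> f p + 0 * g p.
  apply: cvgD; first exact: (cvg_comp (fun q : T * R => q.1) f fstp cf).
  apply: cvgM; last exact: (cvg_comp (fun q : T * R => q.1) g fstp cg).
  by apply: (cvg_trans cvg_snd); exact: cvg_within.
exact: (cvgr_gt _ cvt _ fp0).
Qed.

(** Compactness is used twice, in the form that a property holding near every
    point of a compact set and for parameters near a limit holds on the whole
    set for all parameters near that limit.  It is applied to the unit sphere of
    a trivialization, with parameter the pair of a point of the base and [t],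
    and then to the base, with parameter [t]. *)
Lemma positive_perturbation (E : vector_bundle X) (P Q : forall x, E x -> R) :
  compact [set: X] ->
  fiberwise_continuous P -> fiberwise_continuous Q ->
  homogeneous2 P -> homogeneous2 Q ->
  (forall x v, 0 <= P x v) -> (forall x v, v <> 0 -> P x v = 0 -> 0 < Q x v) ->
  \forall t \near 0^'+, forall x (v : E x), v <> 0 -> 0 < P x v + t * Q x v.
Proof.
move=> cX cP cQ hP hQ P0 Q0.
suff : \forall t \near 0^'+, [set: X] `<=`
    (fun x => forall v : E x, v <> 0 -> 0 < P x v + t * Q x v).
  by apply: filterS => t pos x; exact: pos.
move/compact_near_coveringP : cX; apply => x _.
have [s As sx] := trivs_cover E x.
have sphere : \forall p \near filter_prod (nbhs x) 0^'+,
    [set c : 'rV[R]_(rank E) | `|c| = 1] `<=` (fun c =>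
      0 < P p.1 (triv_vec s p.1 c) + p.2 * Q p.1 (triv_vec s p.1 c)).
  have /compact_near_coveringP := @compact_unit_sphere (rank E).
  apply => c c1.
  have key := near_positive_perturbation (cP s As x c sx) (cQ s As x c sx)
    (fun p => P0 p.1 (triv_vec s p.1 p.2)).
  have vc0 : triv_vec s x c <> 0.
    move/(congr1 (triv_coord s x)); rewrite triv_vecK// linear0 => c0.
    by move: c1; rewrite /= c0 normr0 => /esym/eqP; rewrite oner_eq0.
  have [[U V] /= [[[U1 U2] /= [nU1 nU2] sU] nV] sUV] := key (Q0 _ _ vc0).
  exists (U2, U1 `*` V); first by split=> //; exists (U1, V).
  move=> [c' [y t]] /= [Uc' [Uy Vt]].
  by apply: (sUV ((y, c'), t)); split=> //; exact: (sU (y, c')).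
have near_dom : \forall p \near filter_prod (nbhs x) (0 : R)^'+, triv_dom s p.1.
  apply: (cvg_fst : fst @ filter_prod (nbhs x) (0 : R)^'+ --> nbhs x).
  by apply: open_nbhs_nbhs; split=> //; exact: triv_dom_open.
apply: filterS2 near_dom sphere => -[y t] /= sy pos v v0.
pose c := triv_coord s y v.
have c0 : 0 < `|c|.
  rewrite normr_gt0; apply/eqP => c0; apply: v0.
  by rewrite -(triv_coordK sy v) -/c c0 linear0.
have := pos (`|c|^-1 *: c); rewrite linearZ /= {2 4}/c triv_coordK// hP hQ.
rewrite mulrCA -mulrDr pmulr_rgt0 ?exprn_gt0 ?invr_gt0//; apply.
by rewrite normrZ normfV normr_id mulVf// gt_eqF.
Qed.

Lemma form_ac_continuous (A : lie_algebroid X) (J : almost_complex A)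
    (omega : aform A 2) :
  fiberwise_continuous (fun x (v : A x) => omega x (pair_arg v (J x v))).
Proof.
move=> s As x c sx; have os := triv_dom_open s.
have Seq (g g' : X * 'rV[R]_(rank A) -> R) :
    (forall p, triv_dom s p.1 -> g p = g' p) ->
    {for (x, c), continuous g} -> {for (x, c), continuous g'}.
  move=> gg' cg; have cg' : g @ nbhs (x, c) --> g' (x, c) by rewrite -gg'.
  apply: cvg_trans cg'; apply: near_eq_cvg.
  have : \forall p \near (x, c), triv_dom s p.1.
    by apply: cvg_fst; exact: open_nbhs_nbhs.
  by apply: filterS => p /gg'.
have coord_snd j : {for (x, c), continuous
    (fun p : X * 'rV[R]_(rank A) => p.2 0 j)}.
  exact: (continuous_comp (cvg_snd : {for (x, c), continuous snd})
    (@coord_continuous R _ _ 0 j c)).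
apply: (@form_eval_closed R X A 2 omega s (X * 'rV[R]_(rank A))%type fst
  (fun g => {for (x, c), continuous g}) Seq _ _ _ _
  (fun l p => pair_arg (triv_vec s p.1 p.2) (J p.1 (triv_vec s p.1 p.2)) l)).
- by move=> a; exact: cst_continuous.
- by move=> g g' cg cg'; exact: continuousD.
- by move=> g g' cg cg'; exact: continuousM.
- move=> i.
  have cfr := smooth_fun_on_continuous os (form_smooth omega As i) sx.
  exact: (continuous_comp (cvg_fst : {for (x, c), continuous fst}) cfr).
move=> l j; rewrite /pair_arg; case: (l == ord0).
  by apply: Seq (coord_snd j) => p sp; rewrite triv_vecK.
apply: (Seq (fun p => \sum_i p.2 0 i *
    triv_coord s p.1 (J p.1 (frame s i p.1)) 0 j)).
  move=> p sp; rewrite [X in _ = triv_coord s _ (J _ (triv_vec s _ X)) _ _]row_sum_delta.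
  rewrite !linear_sum summxE; apply: eq_bigr => i _.
  by rewrite !linearZ mxE.
apply: cvg_big => [|i _]; first exact: add_continuous.
apply: continuousM; first exact: coord_snd.
exact: (continuous_comp (cvg_fst : {for (x, c), continuous fst})
  (@ac_continuous _ _ _ J s As i j x sx)).
Qed.

Lemma form_ac_homogeneous (A : lie_algebroid X) (J : almost_complex A)
    (omega : aform A 2) :
  homogeneous2 (fun x (v : A x) => omega x (pair_arg v (J x v))).
Proof.
have lin x (v w : A x) a :
    (omega x (pair_arg (a *: v) w) = a * omega x (pair_arg v w)) *
    (omega x (pair_arg v (a *: w)) = a * omega x (pair_arg v w)).
  have fst_slot u : set_arg (pair_arg v w) ord0 u = pair_arg u w.
    by apply/funext => l; rewrite /set_arg /pair_arg; case: (l == ord0).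
  have snd_slot u : set_arg (pair_arg v w) ord_max u = pair_arg v u.
    by apply/funext => -[[|[|m]] lm].
  split; first by rewrite -(fst_slot (_ *: _)) form_scale fst_slot.
  by rewrite -(snd_slot (_ *: _)) form_scale snd_slot.
by move=> x a v; rewrite linearZ !lin mulrA -expr2.
Qed.

End Positivity.

Theorem theorem4p3 (R : realType) (X Y : manifold R)
    (X_compact : compact [set: X]) (X_connected : connected [set: X])
    (Y_compact : compact [set: Y]) (Y_connected : connected [set: Y])
    (AX : lie_algebroid X) (AY : lie_algebroid Y)
    (f : X -> Y) (phi : lie_algebroid_morphism f AX AY)
    (J : almost_complex AX)
    (omegaY : aform AY 2) (omegaY_symplectic : symplectic omegaY)
    (eta : aform AX 2) (eta_closed : closed_form eta)
    (J_tame : tame_wrt J omegaY phi)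
    (eta_tames : forall x : X, tames_on_kernel phi eta J x) :
  exists omega : aform AX 2, symplectic omega.
Proof.
pose P := pullback_form phi omegaY.
have Pker x (v : AX x) : phi x v = 0 -> P x (pair_arg v (J x v)) = 0.
  move=> v0; rewrite /P /= /pullback.
  rewrite -(form_zero omegaY (fun l => phi x (pair_arg v (J x v) l)) ord0).
  congr (omegaY _ _); apply/funext => l.
  by rewrite /set_arg /pair_arg; case: ifP => //; rewrite v0.
have P0 x (v : AX x) : 0 <= P x (pair_arg v (J x v)).
  by have [/Pker->//|/J_tame/ltW] := pselect (phi x v = 0).
have eta0 x (v : AX x) : v <> 0 -> P x (pair_arg v (J x v)) = 0 ->
    0 < eta x (pair_arg v (J x v)).
  move=> v0 Pv; apply: eta_tames => //; apply: contrapT => /J_tame.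
  by rewrite -[pullback _ _ _]/(P x _) Pv ltxx.
have pos := positive_perturbation X_compact
  (@form_ac_continuous R X AX J P) (@form_ac_continuous R X AX J eta)
  (@form_ac_homogeneous R X AX J P) (@form_ac_homogeneous R X AX J eta) P0 eta0.
have [t post] := @filter_ex _ _ _ _ pos.
exists (form_comb P eta t); split.
  apply: closed_form_comb => //; apply: pullback_closed.
  by case: omegaY_symplectic.
move=> x v v0; apply: contrapT => /(post x).
by have := v0 (J x v); rewrite /= => ->; rewrite ltxx.
Qed.
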